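(* Let $p$ be a prime, let $\mathcal{F}$ be any fusion system over a finite $p$-group $S$, and let $\ell$ be a prime. Let $R_{\overline{\mathbb{F}}_{\ell}}(\mathcal{F})$ be the ring of $\mathcal{F}$-stable $\ell$-Brauer characters, and let $\mathcal{M}_{\ell}$ be a maximal ideal of the ring $\mathcal{R}$ of algebraic integers containing $\ell$, with canonical surjection $\pi_{\ell}:\mathcal{R}\to\mathcal{R}/\mathcal{M}_{\ell}\cong\overline{\mathbb{F}}_{\ell}$. If $B$ is a $\mathbb{Z}$-basis of $R_{\mathbb{C}}(\mathcal{F})$, then $\pi_{\ell}(B)$ is an $\mathbb{F}_{\ell}$-basis of $R_{\overline{\mathbb{F}}_{\ell}}(\mathcal{F})$.
   Context: A fusion system $\mathcal{F}$ over $S$ is a category whose objects are the subgroups of $S$, whose morphism sets $\mathrm{Hom}_{\mathcal{F}}(P,Q)$ consist of injective group homomorphisms $P\to Q$ (with usual composition), such that every homomorphism $P\to Q$ induced by conjugation by an element of $S$ lies in $\mathrm{Hom}_{\mathcal{F}}(P,Q)$, and every morphism is the composite of an isomorphism in $\mathcal{F}$ followed by an inclusion. No saturation is assumed. Two elements $s,s'\in S$ are $\mathcal{F}$-conjugate if some morphism of $\mathcal{F}$ maps $s'$ to $s$. A function is $\mathcal{F}$-stable if it takes equal values on $\mathcal{F}$-conjugate elements. $R_{\mathbb{C}}(\mathcal{F})$ is the ring of $\mathcal{F}$-stable virtual complex characters of $S$. In this statement Brauer characters take values in $\overline{\mathbb{F}}_{\ell}$: the $\ell$-Brauer character of a representation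 $\rho:S\to GL_n(\overline{\mathbb{F}}_{\ell})$ is the function $s\mapsto\mathrm{tr}(\rho(s))\in\overline{\mathbb{F}}_{\ell}$ on the $\ell'$-elements of $S$, i.e. the elements of order prime to $\ell$ (all of $S$ if $\ell\neq p$, only the identity if $\ell=p$). $R^+_{\overline{\mathbb{F}}_{\ell}}(\mathcal{F})$ is the semiring of $\mathcal{F}$-stable $\ell$-Brauer characters of $S$, and $R_{\overline{\mathbb{F}}_{\ell}}(\mathcal{F})$ is its Grothendieck completion. $\mathcal{R}\subset\mathbb{C}$ is the ring of all algebraic integers. For an $\mathcal{R}$-valued function $f$, $\pi_{\ell}(f):=\pi_{\ell}\circ f$, and $\pi_{\ell}(B):=\{\pi_{\ell}(\psi):\psi\in B\}$.
   Formalization: The basis claim is false for ℓ = p and S ≠ 1 (the target is F_p, of dimension 1, while B has at least 2 elements), so it is stated only for ℓ ≠ p or S = 1; for every ℓ it is stated that π_ℓ(B) spans over F_ℓ. *)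

(* Defs.v *)
(* Mathematical Components *)
From HB Require Import structures.
From mathcomp Require Import all_boot all_order all_algebra all_fingroup.
From mathcomp Require Import all_solvable all_field all_character.

Set Implicit Arguments.
Unset Strict Implicit.
Unset Printing Implicit Defensive.

Import GRing.Theory.
Local Open Scope group_scope.
Local Open Scope ring_scope.

(* B is a basis of X over A, where A acts on the ambient group V through act. *)
(* B is read as a finite family, so a basis has no repeated entries.          *)
Section Basis.
Variables (A : nzRingType) (V : zmodType) (act : A -> V -> V).

Definition generates (X : V -> Prop) (B : seq V) : Prop :=
  forall v, X v <-> exists c : 'I_(size B) -> A, v = \sum_i act (c i) B`_i.

Definition independent (B : seq V) : Prop :=
  forall c : 'I_(size B) -> A,
    \sum_i act (c i) B`_i = 0 -> forall i, c i = 0.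

Definition is_basis (X : V -> Prop) (B : seq V) : Prop :=
  generates X B /\ independent B.
End Basis.

Section FusionSystem.
Variables (gT : finGroupType) (S : {group gT}).

(* The objects are the subgroups of S: fus_hom P Q is relevant only when P    *)
(* and Q are contained in S. Morphisms are maps between the types of elements *)
(* of P and Q, so equality of morphisms is equality of maps from P to Q.      *)
(* The identities and the inclusions are instances of fus_conj with g = 1.    *)
Record fusion_system := FusionSystem {
  fus_hom : forall P Q : {group gT}, {set {ffun subg_of P -> subg_of Q}};
  fus_mono : forall (P Q : {group gT}) (f : {ffun subg_of P -> subg_of Q}),
    P \subset S -> Q \subset S -> f \in fus_hom P Q ->
    injective f /\ {morph f : x y / (x * y)%g};
  fus_comp : forall (P Q R : {group gT}) (f : {ffun subg_of P -> subg_of Q})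
      (h : {ffun subg_of Q -> subg_of R}),
    P \subset S -> Q \subset S -> R \subset S ->
    f \in fus_hom P Q -> h \in fus_hom Q R ->
    [ffun x => h (f x)] \in fus_hom P R;
  fus_conj : forall (P Q : {group gT}) (f : {ffun subg_of P -> subg_of Q}) g,
    P \subset S -> Q \subset S -> g \in S ->
    (forall x, sgval (f x) = (sgval x ^ g)%g) -> f \in fus_hom P Q;
  fus_factor : forall (P Q : {group gT}) (f : {ffun subg_of P -> subg_of Q}),
    P \subset S -> Q \subset S -> f \in fus_hom P Q ->
    exists (R : {group gT}) (phi : {ffun subg_of P -> subg_of R})
           (psi : {ffun subg_of R -> subg_of P}),
      [/\ R \subset Q, phi \in fus_hom P R, psi \in fus_hom R P,
          cancel phi psi /\ cancel psi phi &
          forall x, sgval (f x) = sgval (phi x)]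
}.

Variable F : fusion_system.

Definition fus_conjugate (s s' : gT) : Prop :=
  exists (P Q : {group gT}) (f : {ffun subg_of P -> subg_of Q})
         (x : subg_of P),
    [/\ P \subset S, Q \subset S, f \in fus_hom F P Q,
        sgval x = s' & sgval (f x) = s].

(* Functions on a set of elements of S are given on an index type I, with     *)
(* elt i the element of S indexed by i.                                       *)
Definition fus_stable (I : Type) (elt : I -> gT) (T : Type) (f : I -> T) :=
  forall i j, fus_conjugate (elt i) (elt j) -> f i = f j.

(* R_C(F). The field algC of algebraic numbers replaces C: every complex      *)
(* character of a finite group takes its values there.                        *)
Definition stable_vchar (phi : 'CF(S)) : Prop :=
  phi \in 'Z[irr S] /\ fus_stable id phi.

Variable l : nat.

Definition l'_elements : {set gT} := [set x in S | l^'.-elt x].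

Definition l'_elt := {x : gT | x \in l'_elements}.

Variable K : fieldType.

Definition brauer_char (n : nat) (rho : mx_representation K S n) :
  {ffun l'_elt -> K} := [ffun s => \tr (rho (val s))].

(* R^+_K(F), for K an algebraic closure of F_l. *)
Definition stable_brauer_char (f : {ffun l'_elt -> K}) : Prop :=
  (exists n (rho : mx_representation K S n), f = brauer_char rho) /\
  fus_stable val f.

(* R_K(F). The additive monoid R^+_K(F) is cancellative, being contained in a *)
(* ring of functions, so its Grothendieck completion is its set of differences*)
(* in that ring.                                                              *)
Definition stable_virtual_brauer_char (f : {ffun l'_elt -> K}) : Prop :=
  exists f1 f2,
    [/\ stable_brauer_char f1, stable_brauer_char f2 & f = f1 - f2].

End FusionSystem.

Record algint := AlgInt { algint_val : algC; _ : algint_val \in Aint }.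
HB.instance Definition _ := [isSub for algint_val].
HB.instance Definition _ := [Choice of algint by <:].
HB.instance Definition _ := [SubChoice_isSubComNzRing of algint by <:].

(* idealr_closed includes properness. *)
Definition maximal_ideal (R : nzRingType) (M : {pred R}) : Prop :=
  idealr_closed M /\
  forall J : {pred R}, idealr_closed J -> {subset M <= J} -> {subset J <= M}.

Definition is_algebraic_closure_Fp (l : nat) (K : closedFieldType) : Prop :=
  l \in [pchar K] /\
  forall x : K, algebraicOver (fun a : 'F_l => (a : nat)%:R : K) x.

(* pi \o psi, restricted to the l'-elements of S. The default value 0 is not  *)
(* used for virtual characters, all of whose values lie in Aint.              *)
Definition reduction (gT : finGroupType) (S : {group gT}) (l : nat)
    (K : fieldType) (pi : algint -> K) (psi : 'CF(S)) : {ffun l'_elt S l -> K} :=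
  [ffun s => pi (insubd (0 : algint) (psi (val s)))].

Definition Zact (V : zmodType) (a : int) (v : V) : V := v *~ a.

(* A genuine action of the field F_l on groups V of exponent l. *)
Definition Flact (l : nat) (V : zmodType) (a : 'F_l) (v : V) : V := v *+ a.

Arguments stable_virtual_brauer_char {gT S} F l K f.

(* Main.v *)
(* Let n = #|S| and suppose that l does not divide n. Write phi_j for the     *)
(* reduction of the irreducible character 'chi_j. Reducing the orthogonality  *)
(* relations gives central idempotents of K[S] and shows that the traces of   *)
(* K-representations of S are exactly the F_l-combinations of the phi_j,      *)
(* which are K-linearly independent. It follows at once that a virtual        *)
(* character with zero reduction is divisible by l, whence the independence   *)
(* of pi(B). For the generation, fix a primitive n-th root of unity z. For r  *)
(* in S and i < n the function x |-> n * sum_k z^(ik) [x ~ r^k], with k       *)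
(* ranging over the units mod n and ~ denoting fusion, is a stable virtual    *)
(* character, and n^2 [x ~ r] is a combination of these functions with        *)
(* coefficients z^(-i). As n is invertible in K, every stable function S -> K *)
(* is thus a K-linear combination of reductions of stable virtual characters. *)
(* If moreover it is an F_l-combination of the phi_j, then it is even an F_l- *)
(* combination of such reductions, because a linear system over F_l solvable  *)
(* in K is solvable in F_l. If l divides n, then l = p and the only           *)
(* l'-element of S is 1.                                                      *)
Require Import Defs.
From HB Require Import structures.
From mathcomp Require Import all_boot all_order all_algebra all_fingroup.
From mathcomp Require Import all_solvable all_field all_character.

Set Implicit Arguments.
Unset Strict Implicit.
Unset Printing Implicit Defensive.

Import GRing.Theory Num.Theory.
Local Open Scope group_scope.
Local Open Scope ring_scope.

(** * Representations over a field of characteristic prime to the group order *)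

(** Suppose l is prime to #|S|. Reduction then maps the stable virtual characters onto the stable
    virtual Brauer characters, and its kernel consists of the multiples of l. Hence a Z-basis B
    becomes an F_l-basis. The values lie in the target by [stable_virtual_of_vchar]: since -1 is a
    natural number mod l, every integral combination of the phi_j is the trace of a genuine
    representation. Surjectivity is [virtual_brauer_reduction]: [repr_trace_irr_residue] expands a
    Brauer character in the phi_j over the prime field, and [stable_reduction_lift] lifts a stable
    expansion by means of [fus_delta_inversion], [irr_residue_free] and [Fp_descent]. The kernel is
    computed by [reduction_eq0]; the quotient of a stable function by l is stable because algC has
    characteristic 0.

    If l = p, only the degree mod l survives and the target is a copy of F_l. Reduction is still
    onto, but if S is nontrivial the trivial and the regular character are independent and stable,
    so B has more than one element and its reduction cannot be independent. Only generation then
    remains. *)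

Lemma idempotent_subrepr (K : fieldType) (gT : finGroupType) (G : {group gT})
    (n : nat) (rG : mx_representation K G n) (E : 'M[K]_n) :
    E *m E = E -> {in G, forall g, E *m rG g = rG g *m E} ->
  exists r (sG : mx_representation K G r),
    {in G, forall g, \tr (sG g) = \tr (E *m rG g)}.
Proof.
(* Factor [E] through its rank [r]. Cancelling the one-sided inverses of [C] and [R] in [E *m E = E]
   leaves [R *m C = 1], so [R *m rG g *m C] is the action on the image of [E]. *)
move=> idE cE; have [r [C [R [CR RC]]]] :
    exists r (C : 'M_(n, r)) (R : 'M_(r, n)),
      C *m R = E /\ R *m C = 1%:M.
  have := mulmx_base E.
  have /row_freeP[] := row_base_free E; have /row_fullP[] := col_base_full E.
  move: (\rank E) (col_base E) (row_base E) => r C R C' C'C R' RR' CR.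
  exists r, C, R; split=> //.
  transitivity (C' *m (C *m R *m (C *m R)) *m R').
    by rewrite -!mulmxA RR' mulmx1 !mulmxA C'C mul1mx.
  by rewrite CR idE -CR mulmxA C'C mul1mx RR'.
have RE : R *m E = R by rewrite -CR mulmxA RC mul1mx.
have sub_repr : mx_repr G (fun g => R *m rG g *m C).
  split=> [|x y Gx Gy]; first by rewrite repr_mx1 mulmx1.
  rewrite !mulmxA -(mulmxA _ C R) CR -(mulmxA R (rG x) E) -cE //.
  by rewrite mulmxA RE repr_mxM // !mulmxA.
exists r, (MxRepresentation sub_repr) => g _.
by rewrite /= mxtrace_mulC mulmxA CR.
Qed.

(** Right translation by [g] permutes the basis, without fixed points unless [g] is 1. *)
Lemma mxtrace_regular (K : fieldType) (gT : finGroupType) (G : {group gT}) g :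
  g \in G -> \tr (regular_repr K G g) = #|G|%:R *+ (g == 1%g).
Proof.
move=> Gg; rewrite /mxtrace /= (eq_bigr (fun=> (g == 1%g)%:R)) => [|i _].
  by rewrite sumr_const card_ord; case: eqP => _ //; rewrite mul0rn.
rewrite !mxE eqxx /=; congr (_%:R); congr (nat_of_bool _).
have Gi := enum_valP i; apply/eqP/eqP=> [|->].
  move/(congr1 enum_val); rewrite gring_indexK ?groupM // => eq_i.
  by apply: (mulgI (enum_val i)); rewrite mulg1.
by rewrite mulg1 gring_valK.
Qed.

(** * Reduction of algebraic integers *)

Section ResidueOfAlgebraicIntegers.
Variables (K : fieldType) (pi : {rmorphism algint -> K}).

(** [pi] is extended by 0 outside [Aint], so that it applies directly to character values; the
    morphism laws are stated on [Aint]. *)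
Definition residue (x : algC) : K := pi (insubd 0 x).

Lemma residueD : {in Aint &, {morph residue : x y / x + y}}.
Proof.
move=> x y Ax Ay; rewrite /residue -rmorphD; congr (pi _); apply: val_inj.
by rewrite rmorphD /= !insubdK // rpredD.
Qed.

Lemma residueM : {in Aint &, {morph residue : x y / x * y}}.
Proof.
move=> x y Ax Ay; rewrite /residue -rmorphM; congr (pi _); apply: val_inj.
by rewrite rmorphM /= !insubdK // rpredM.
Qed.

Lemma residue_int (m : int) : residue m%:~R = m%:~R.
Proof.
rewrite /residue -(rmorph_int pi); congr (pi _); apply: val_inj.
by rewrite rmorph_int insubdK // Aint_int.
Qed.

Lemma residue_nat (m : nat) : residue m%:R = m%:R.
Proof. exact: (residue_int m). Qed.

Lemma residue0 : residue 0 = 0. Proof. exact: (residue_nat 0). Qed.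

Lemma residue1 : residue 1 = 1. Proof. exact: (residue_nat 1). Qed.

Lemma residue_sum (I : Type) (r : seq I) (P : pred I) (f : I -> algC) :
  (forall i, P i -> f i \in Aint) ->
  residue (\sum_(i <- r | P i) f i) = \sum_(i <- r | P i) residue (f i).
Proof.
move=> Af; suff [] : residue (\sum_(i <- r | P i) f i)
    = \sum_(i <- r | P i) residue (f i)
    /\ \sum_(i <- r | P i) f i \in Aint by [].
elim/big_rec2: _ => [|i x y Pi [<- Ay]]; first by rewrite residue0.
by rewrite residueD ?rpredD ?Af.
Qed.

End ResidueOfAlgebraicIntegers.
(** Fermat's little theorem: [d ^ l = d] in K, so [d ^ l.-2] inverts a nonzero [d]. *)
Lemma natr_div_pchar (K : fieldType) (l m d : nat) :
  l \in [pchar K] -> d%:R != 0 :> K -> exists a, m%:R / d%:R = a%:R :> K.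
Proof.
move=> lK nz_d; have l_gt1 := prime_gt1 (pcharf_prime lK).
exists (m * d ^ l.-2)%N; rewrite natrM natrX; congr (_ * _).
apply: (mulIf nz_d); rewrite mulVf // -exprSr prednK; last first.
  by case: l l_gt1 {lK} => [|[]].
apply: (mulIf nz_d); rewrite mul1r -exprSr prednK ?(ltnW l_gt1) //.
by rewrite -(pFrobenius_autE lK) pFrobenius_aut_nat.
Qed.

(** Since -1 equals [l.-1] in K, integral coefficients can serve as multiplicities of
    representations. *)
Lemma intr_pchar_nat (K : fieldType) (l : nat) (m : int) :
  l \in [pchar K] -> exists a : nat, m%:~R = a%:R :> K.
Proof.
move=> lK; case: m => n; first by exists n.
exists (n.+1 * l.-1)%N; rewrite NegzE mulrNz natrM.
have ->: l.-1%:R = -1 :> K.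
  apply/eqP; rewrite -addr_eq0 natr1 prednK ?prime_gt0 ?(pcharf_prime lK) //.
  by rewrite (pcharf0 lK).
by rewrite mulrN1.
Qed.

Section ReprTrace.
Variables (K : fieldType) (gT : finGroupType) (G : {group gT}).

Definition repr_trace (f : gT -> K) : Prop :=
  exists n (rG : mx_representation K G n), {in G, forall g, f g = \tr (rG g)}.

Lemma repr_trace0 : repr_trace (fun=> 0).
Proof.
by exists 0, grepr0 => g _; rewrite /mxtrace big_ord0.
Qed.

Lemma repr_traceD f1 f2 :
  repr_trace f1 -> repr_trace f2 -> repr_trace (fun g => f1 g + f2 g).
Proof.
move=> [n1 [r1 tr1]] [n2 [r2 tr2]].
exists _, (dadd_grepr (Representation r1) (Representation r2)) => g Gg.
by rewrite tr1 // tr2 // /= mxtrace_block.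
Qed.

Lemma repr_trace_natr (m : nat) f :
  repr_trace f -> repr_trace (fun g => m%:R * f g).
Proof.
move=> trf; elim: m => [|m IHm].
  by have [n [r tr]] := repr_trace0; exists n, r => g Gg; rewrite mul0r -tr.
have [n [r tr]] := repr_traceD trf IHm; exists n, r => g Gg.
by rewrite -tr // mulrSr mulrDl mul1r addrC.
Qed.

Lemma repr_trace_sum (I : Type) (s : seq I) (f : I -> gT -> K) :
  (forall i, repr_trace (f i)) -> repr_trace (fun g => \sum_(i <- s) f i g).
Proof.
move=> trf; elim: s => [|i s IHs].
  by have [n [r tr]] := repr_trace0; exists n, r => g Gg; rewrite big_nil -tr.
have [n [r tr]] := repr_traceD (trf i) IHs; exists n, r => g Gg.
by rewrite big_cons -tr.
Qed.

End ReprTrace.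

(** * Orthogonality and projectors for reduced irreducible characters *)

Section IrreducibleResidues.
Variables (K : fieldType) (pi : {rmorphism algint -> K}).
Variables (gT : finGroupType) (G : {group gT}).
Hypothesis nzG : #|G|%:R != 0 :> K.

Definition irr_residue (i : Iirr G) (x : gT) : K := residue pi ('chi_i x).

Local Notation phi := irr_residue.

Lemma irr_residue1_nat i : exists2 d : nat, phi i 1%g = d%:R & (d %| #|G|)%N.
Proof.
have /natrP[d def_d] := Cnat_irr1 i; exists d.
  by rewrite /phi def_d residue_nat.
by have := dvd_irr1_cardG i; rewrite def_d dvdC_nat.
Qed.

Lemma irr_residue1_neq0 i : phi i 1%g != 0.
Proof.
have [d -> /dvdnP[q def_n]] := irr_residue1_nat i.
by apply: contraNneq nzG => d0; rewrite def_n natrM d0 mulr0.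
Qed.

Lemma irr_residueJ i x y : y \in G -> phi i (x ^ y) = phi i x.
Proof. by move=> Gy; rewrite /phi cfunJ. Qed.

(** The generalized orthogonality relation, with the denominators #|G| and 'chi_i(1) cleared so that
    both sides are algebraic integers and can be reduced. *)
Lemma irr_residue_conv i j y :
  phi i 1%g * (\sum_(x in G) phi i (x * y)%g * phi j x^-1%g)
    = #|G|%:R * ((i == j)%:R * phi i y).
Proof.
have Achi k x : 'chi[G]_k x \in Aint by apply: Aint_irr.
transitivity (residue pi (#|G|%:R * ((i == j)%:R * 'chi_i y))); last first.
  by rewrite !residueM ?residue_nat ?rpredM ?rpred_nat.
transitivity (residue pi ('chi_i 1%g *
    \sum_(x in G) 'chi_i (x * y)%g * 'chi_j x^-1%g)).
  rewrite residueM ?rpred_sum // => [|x _]; last exact: rpredM.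
  rewrite residue_sum => [|x _]; last exact: rpredM.
  by congr (_ * _); apply: eq_bigr => x _; rewrite residueM.
congr (residue pi _); have nzn : #|G|%:R != 0 :> algC by apply: neq0CG.
apply: (mulfI (invr_neq0 nzn)); rewrite mulKf // mulrCA.
rewrite generalized_orthogonality_relation mulrCA; congr (_ * _).
by rewrite mulrC divfK ?irr1_neq0.
Qed.

Lemma irr_residue_orthogonality i j :
  \sum_(x in G) phi i x * phi j x^-1%g = #|G|%:R *+ (i == j).
Proof.
apply: (mulfI (irr_residue1_neq0 i)).
under eq_bigr => x _ do rewrite -[x in phi i x]mulg1.
rewrite irr_residue_conv; case: eqP => _; rewrite ?mul0r ?mulr0 ?mul1r //.
by rewrite mulrC.
Qed.

Lemma irr_residue_orthogonality2 x y : y \in G ->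
  \sum_i phi i x * phi i y^-1%g = #|'C_G[x]|%:R *+ (x \in y ^: G).
Proof.
move=> Gy; have Achi k z : 'chi[G]_k z \in Aint by apply: Aint_irr.
transitivity (residue pi (#|'C_G[x]|%:R *+ (x \in y ^: G))); last first.
  by rewrite -mulr_natr -natrM residue_nat natrM mulr_natr.
rewrite -(second_orthogonality_relation x Gy) residue_sum => [|k _].
  by apply: eq_bigr => k _; rewrite -irr_inv residueM.
by rewrite -irr_inv rpredM.
Qed.
Section Representation.
Variables (n : nat) (rG : mx_representation K G n).

(* The image in rG of the reduction of the central idempotent of 'chi_j. *)
Definition irr_projector (j : Iirr G) : 'M[K]_n :=
  \sum_(s in G) (phi j 1%g / #|G|%:R * phi j s^-1%g) *: rG s.

(** The coefficients form an idempotent for convolution, by [irr_residue_conv] with equal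
    indices. *)
Lemma irr_projector_idem j : irr_projector j *m irr_projector j = irr_projector j.
Proof.
set c := fun s => phi j 1%g / #|G|%:R * phi j s^-1%g.
have cc u : u \in G -> \sum_(s in G) c s * c (s^-1 * u)%g = c u.
  move=> Gu; rewrite /c.
  transitivity ((phi j 1%g / #|G|%:R) ^+ 2 *
      \sum_(s in G) phi j (s * u^-1)%g * phi j s^-1%g).
    rewrite mulr_sumr; apply: eq_bigr => s Gs.
    rewrite invMg invgK mulrACA -expr2; congr (_ * _).
    (* [u^-1 * s] is conjugate to [s * u^-1], which gives the form of [irr_residue_conv]. *)
    rewrite mulrC -(irr_residueJ j (u^-1 * s)%g (groupVr Gu)).
    by rewrite conjgE invgK -mulgA mulKVg.
  set sum := \sum_(s in G) _; rewrite expr2 -mulrA; congr (_ * _).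
  by rewrite mulrAC irr_residue_conv eqxx mul1r mulrC mulKf.
rewrite mulmx_suml.
under eq_bigr => s Gs.
  rewrite mulmx_sumr (reindex_inj (mulgI s^-1%g)) /=.
  under eq_big => [t|t]; first by rewrite groupMl ?groupV //; over.
    rewrite groupMl ?groupV // => Gt.
    rewrite -scalemxAl -scalemxAr scalerA -repr_mxM ?groupM ?groupV // mulKVg.
    over.
  over.
rewrite exchange_big /=; apply: eq_bigr => u Gu.
by rewrite -scaler_suml cc.
Qed.

Lemma irr_projector_comm j :
  {in G, forall g, irr_projector j *m rG g = rG g *m irr_projector j}.
Proof.
move=> g Gg; rewrite mulmx_suml mulmx_sumr [RHS](reindex_inj (conjg_inj g)) /=.
apply: eq_big => [s|s Gs]; first by rewrite groupJr.
rewrite -scalemxAl -scalemxAr -!repr_mxM ?groupJ // -conjgC.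
by rewrite -conjVg irr_residueJ.
Qed.

(** The usual inner product of the trace of [rG] with the j-th irreducible character, computed in
    K. *)
Definition irr_mult (j : Iirr G) : K :=
  #|G|%:R^-1 * \sum_(s in G) phi j s^-1%g * \tr (rG s).

(** Both sides are the trace of [irr_projector j], which is the degree of the representation on its
    image. *)
Lemma irr_mult_nat j : exists m : nat, phi j 1%g * irr_mult j = m%:R.
Proof.
have [r [sG tr_sG]] := idempotent_subrepr (irr_projector_idem j)
  (irr_projector_comm j).
exists r; have := tr_sG _ (group1 G).
rewrite !repr_mx1 mxtrace1 mulmx1 => ->.
rewrite raddf_sum mulrA mulr_sumr /=; apply: eq_bigr => s _.
by rewrite mxtraceZ mulrA.
Qed.

(** Summing over [j] first, column orthogonality leaves only the [s] in the class of [g], where the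
    trace is constant; class size times centralizer order is #|G|. *)
Lemma mxtrace_irr_mult g : g \in G ->
  \tr (rG g) = \sum_j irr_mult j * phi j g.
Proof.
move=> Gg; transitivity (#|G|%:R^-1 * \sum_(s in G) \tr (rG s) *
    \sum_j phi j g * phi j s^-1%g); last first.
  under [RHS]eq_bigr => j _ do rewrite /irr_mult -mulrA mulr_suml.
  rewrite -mulr_sumr exchange_big /=; congr (_ * _); apply: eq_bigr => s _.
  rewrite mulr_sumr; apply: eq_bigr => j _.
  by rewrite mulrA mulrC mulrA.
transitivity (#|G|%:R^-1 * \sum_(s in g ^: G) \tr (rG g) * #|'C_G[g]|%:R).
  rewrite sumr_const -[X in _ * X]mulr_natr -[X in _ * X]mulrA -natrM.
  by rewrite -index_cent1 Lagrange ?subsetIl // mulrC mulfK.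
congr (_ * _); rewrite [RHS](bigID (mem (g ^: G))) /=.
rewrite [X in _ = _ + X]big1 ?addr0 => [|s /andP[Gs ngs]]; last first.
  by rewrite irr_residue_orthogonality2 // class_sym (negPf ngs) mulr0n mulr0.
apply: eq_big => [s|s gs].
  apply/idP/andP=> [gs|[]//]; split=> //.
  by apply: (subsetP (class_subG Gg (subxx _))).
have Gs : s \in G by apply: (subsetP (class_subG Gg (subxx _))).
rewrite irr_residue_orthogonality2 // class_sym gs mulr1n; congr (_ * _).
have /imsetP[x Gx ->] := gs.
rewrite /conjg !repr_mxM ?groupM ?groupV // mxtrace_mulC -mulmxA.
by rewrite -repr_mxM ?groupV // mulgV repr_mx1 mulmx1.
Qed.
End Representation.

Variable l : nat.
Hypothesis lK : l \in [pchar K].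

(* The multiplicity of phi j is r / d, where r is the rank of irr_projector j *)
(* and d = 'chi_j 1; hence it lies in the prime field.                        *)
Lemma repr_trace_irr_residue f : repr_trace G f ->
  exists a : Iirr G -> nat, {in G, forall g, f g = \sum_j (a j)%:R * phi j g}.
Proof.
move=> [n [rG trf]].
have /fin_all_exists[a def_a] j : exists a : nat, irr_mult rG j = a%:R.
  have [m def_m] := irr_mult_nat rG j; have [d def_d _] := irr_residue1_nat j.
  have nz_d : d%:R != 0 :> K by rewrite -def_d irr_residue1_neq0.
  have [a def_a] := natr_div_pchar m lK nz_d; exists a.
  by rewrite -def_a -def_m def_d mulrC mulKf.
exists a => g Gg; rewrite trf // mxtrace_irr_mult //.
by apply: eq_bigr => j _; rewrite def_a.
Qed.

(* The central idempotent of 'chi_j cuts out of the regular representation a  *)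
(* module of trace d * phi j, d = 'chi_j 1, and d is invertible mod l.        *)
Lemma irr_residue_repr_trace j : repr_trace G (phi j).
Proof.
have [d def_d _] := irr_residue1_nat j.
have nz_d : d%:R != 0 :> K by rewrite -def_d irr_residue1_neq0.
have [a def_a] := natr_div_pchar 1 lK nz_d.
pose rG := regular_repr K G.
have [n [sG tr_sG]] := idempotent_subrepr (irr_projector_idem rG j)
  (irr_projector_comm rG j).
have trd : repr_trace G (fun g => d%:R * phi j g).
  exists n, sG => g Gg; rewrite tr_sG // mulmx_suml raddf_sum /=.
  rewrite (bigD1 g^-1%g) ?groupV //= big1 ?addr0 => [|s /andP[Gs ne_s]].
    rewrite -scalemxAl mxtraceZ -repr_mxM ?groupV // mulVg repr_mx1 mxtrace1.
    by rewrite invgK def_d mulrAC mulrC divfK // mulrC.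
  rewrite -scalemxAl mxtraceZ -repr_mxM // mxtrace_regular ?groupM //.
  by rewrite -(inj_eq (mulIg g^-1%g)) mulgK mul1g (negPf ne_s) mulr0.
have [m [r trm]] := repr_trace_natr a trd; exists m, r => g Gg.
by rewrite -trm // -def_a mul1r mulKf.
Qed.

Lemma irr_residue_comb_repr_trace (a : Iirr G -> int) :
  repr_trace G (fun g => \sum_j (a j)%:~R * phi j g).
Proof.
apply: repr_trace_sum => j; have [b ->] := intr_pchar_nat (a j) lK.
exact/repr_trace_natr/irr_residue_repr_trace.
Qed.
End IrreducibleResidues.
(** * Stable virtual characters attached to a fusion class *)

Lemma sum_expr_unity (R : idomainType) (n : nat) (w : R) :
  w ^+ n = 1 -> \sum_(k < n) w ^+ k = n%:R *+ (w == 1).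
Proof.
move=> wn1; have [-> | w_neq1] := eqVneq w 1.
  by under eq_bigr do rewrite expr1n; rewrite sumr_const card_ord.
apply/eqP; rewrite mulr0n -(mulrI_eq0 _ (mulfI (_ : w - 1 != 0))) ?subr_eq0 //.
by rewrite -subrX1 wn1 subrr.
Qed.

Lemma sum_dvdn_mul (V : zmodType) (p q : nat) (f : nat -> V) : (0 < p)%N ->
  \sum_(k < p * q | (p %| k)%N) f k = \sum_(j < q) f (p * j)%N.
Proof.
move=> p_gt0; have [-> | q_gt0] := posnP q.
  by rewrite muln0 !big_ord0.
case: q q_gt0 => // q _; have lt_pq (j : 'I_q.+1) : (p * j < p * q.+1)%N.
  by rewrite ltn_pmul2l.
rewrite (reindex_onto (fun j => Ordinal (lt_pq j))
  (fun k : 'I_(p * q.+1) => inord (k %/ p))) /=.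
  apply: eq_bigl => j; rewrite dvdn_mulr //= mulKn //.
  by apply/eqP; apply: val_inj; rewrite /= inordK.
move=> k p_k; have ltq : (k %/ p < q.+1)%N 
  by rewrite ltn_divLR // (leq_trans (ltn_ord k)) // mulnC.
by apply: val_inj; rewrite [LHS]/= inordK // [LHS]mulnC divnK.
Qed.

(* The full sum minus the sum over the multiples of p: both are full sums of  *)
(* powers of a root of unity, equal to 0 or to the number of their terms.     *)
Lemma ramanujan_sum_int (p m : nat) (w : algC) : prime p -> w ^+ (p ^ m) = 1 ->
  \sum_(k < p ^ m | coprime (p ^ m) k) w ^+ k \is a Num.int.
Proof.
move=> p_pr wn1; have int_sum n (v : algC) :
    v ^+ n = 1 -> \sum_(k < n) v ^+ k \is a Num.int.
  by move=> vn1; rewrite sum_expr_unity // rpredMn // rpred_nat.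
case: m wn1 => [|m] wn1.
  rewrite (eq_bigl predT) => [|k]; last exact: coprime1n.
  exact: int_sum.
have -> : \sum_(k < p ^ m.+1 | coprime (p ^ m.+1) k) w ^+ k
    = \sum_(k < p ^ m.+1) w ^+ k
      - \sum_(k < p ^ m.+1 | (p %| k)%N) w ^+ k.
  rewrite [in RHS](bigID (fun k : 'I__ => (p %| k)%N)) /= addrAC subrr add0r.
  by apply: eq_bigl => k; rewrite coprime_pexpl // prime_coprime.
rewrite rpredB ?int_sum // expnS sum_dvdn_mul ?prime_gt0 //.
under eq_bigr do rewrite exprM.
by rewrite int_sum // -exprM -expnS.
Qed.

(** The [e i] are the eigenvalues of [x]; one diagonalization serves all powers of [x]. *)
Lemma char_expg_sum (gT : finGroupType) (G : {group gT}) (chi : 'CF(G)) x :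
  chi \is a character -> x \in G ->
  exists n (e : 'I_n -> algC), (forall i, e i ^+ #|G| = 1) /\
    forall k, chi (x ^+ k)%g = \sum_i e i ^+ k.
Proof.
move=> /char_reprP[[n rG] ->] Gx.
have [e [[B unitB rGx] [e1 _] _ _]] := repr_rsim_diag rG Gx.
exists n, (fun i => e 0 i); split=> [i|k].
  by have /dvdnP[q ->] := order_dvdG Gx; rewrite mulnC exprM e1 expr1n.
rewrite cfunE groupX // mulr1n.
have -> : rG (x ^+ k)%g = invmx B *m diag_mx (\row_i e 0 i ^+ k) *m B.
  elim: k => [|k IHk].
    rewrite expg0 repr_mx1 (_ : diag_mx _ = 1%:M) ?mulmx1 ?mulVmx //.
    by rewrite -diag_const_mx; congr diag_mx; apply/rowP=> i; rewrite !mxE.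
  rewrite expgS repr_mxM ?groupX // IHk rGx !mulmxA mulmxK //.
  rewrite -(mulmxA (invmx B) (diag_mx e)) mulmx_diag; congr (_ *m diag_mx _ *m _).
  by apply/rowP=> i; rewrite !mxE exprS.
rewrite mxtrace_mulC mulmxA mulmxV // mul1mx mxtrace_diag.
by apply: eq_bigr => i _; rewrite mxE.
Qed.

(** * Fusion classes and power maps *)

Section FusionClasses.
Variables (gT : finGroupType) (S : {group gT}) (F : fusion_system S).

(** A boolean form of [fus_conjugate], to which [connect] and [fingraph.root] apply. *)
Definition fus_rel : rel gT := fun s s' =>
  [exists P : {group gT}, [exists Q : {group gT},
   [exists f : {ffun subg_of P -> subg_of Q}, [exists x : subg_of P,
     [&& P \subset S, Q \subset S, f \in fus_hom F P Q,
         sgval x == s' & sgval (f x) == s]]]]].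

Lemma fus_relP s s' : reflect (fus_conjugate F s s') (fus_rel s s').
Proof.
apply: (iffP existsP) => [[P /existsP[Q /existsP[f /existsP[x]]]]|].
  by case/and5P=> sP sQ Ff /eqP def_s' /eqP def_s; exists P, Q, f, x.
move=> [P [Q [f [x [sP sQ Ff def_s' def_s]]]]]; exists P.
apply/existsP; exists Q; apply/existsP; exists f; apply/existsP; exists x.
by rewrite sP sQ Ff def_s' def_s !eqxx.
Qed.

(** By the factorization axiom a morphism [f] is an isomorphism [phi] followed by an inclusion; the
    inverse of [phi] lies in the fusion system and maps [f x] back to [x]. *)
Lemma fus_rel_sym : symmetric fus_rel.
Proof.
suff sym s s' : fus_rel s s' -> fus_rel s' s.
  by move=> s s'; apply/idP/idP => /sym.
case/fus_relP=> [P [Q [f [x [sP sQ Ff def_s' def_s]]]]].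
have [R [phi [psi [sRQ _ Fpsi [phiK _] def_f]]]] := fus_factor sP sQ Ff.
apply/fus_relP; exists R, P, psi, (phi x).
by split; rewrite ?phiK // -?def_f // (subset_trans sRQ).
Qed.

Lemma fus_rel_expg k s s' : fus_rel s s' -> fus_rel (s ^+ k)%g (s' ^+ k)%g.
Proof.
case/fus_relP=> [P [Q [f [x [sP sQ Ff <- <-]]]]].
have [_ fM] := fus_mono sP sQ Ff.
have f1 : f 1%g = 1%g by apply: (mulgI (f 1%g)); rewrite -fM !mulg1.
have fX : f (x ^+ k)%g = (f x ^+ k)%g.
  by elim: k => [|k IHk]; rewrite ?expg0 // !expgS fM IHk.
have valX (R : {group gT}) (y : subg_of R) : sgval (y ^+ k)%g = (sgval y ^+ k)%g.
  by elim: k {fX} => [|k IHk]; rewrite ?expg0 // !expgS /= IHk.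
by apply/fus_relP; exists P, Q, f, (x ^+ k)%g; split; rewrite ?fX ?valX.
Qed.

Lemma fus_rel_conjg : {in S &, forall x g, fus_rel x (x ^ g)%g}.
Proof.
move=> x g Sx Sg; rewrite fus_rel_sym; apply/fus_relP.
exists S, S, [ffun y => subg S (sgval y ^ g)], (subg S x).
have SJ y : sgval y \in S -> (sgval y ^ g \in S)%g by move=> ?; rewrite groupJ.
split=> //; rewrite ?subgK //; last by rewrite ffunE !subgK ?groupJ // subgK.
apply: (@fus_conj _ _ F S S _ g) => // y; rewrite ffunE subgK //.
exact/SJ/subgP.
Qed.

Definition fus_class (x : gT) : {set gT} := [set y in connect fus_rel x].

Lemma mem_fus_class x y : (y \in fus_class x) = connect fus_rel x y.
Proof. by rewrite inE. Qed.

Lemma fus_class_sym x y : (x \in fus_class y) = (y \in fus_class x).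
Proof. by rewrite !mem_fus_class (sym_connect_sym fus_rel_sym). Qed.

Lemma fus_class_trans x y z :
  y \in fus_class x -> z \in fus_class y -> z \in fus_class x.
Proof. by rewrite !mem_fus_class => /connect_trans; apply. Qed.

Lemma fus_class_stable (T : Type) (f : gT -> T) x y :
  (forall s s', fus_conjugate F s s' -> f s = f s') ->
  y \in fus_class x -> f y = f x.
Proof.
move=> f_stable; rewrite mem_fus_class => /connectP[s + ->].
elim: s x => //= z s IHs x /andP[/fus_relP/f_stable -> /IHs].
by [].
Qed.

Lemma fus_class_expg k x y :
  y \in fus_class x -> (y ^+ k)%g \in fus_class (x ^+ k)%g.
Proof.
rewrite !mem_fus_class => /connectP[s + ->].
elim: s x => [|z s IHs] x /=; first by rewrite connect0.
case/andP=> /(fus_rel_expg k)/connect1 xz /IHs; exact: connect_trans.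
Qed.

Lemma fus_class_subset x : x \in S -> fus_class x \subset S.
Proof.
move=> Sx; apply/subsetP=> y; rewrite mem_fus_class => /connectP[s + ->].
elim: s x Sx => //= z s IHs x Sx /andP[/fus_relP xz]; apply: IHs.
case: xz => [P [Q [f [u [sP _ _ <- _]]]]].
exact: (subsetP sP) (subgP u).
Qed.

Lemma fus_class_normal x : x \in S -> fus_class x <| S.
Proof.
move=> Sx; rewrite /normal fus_class_subset //; apply/subsetP=> g Sg.
rewrite inE; apply/subsetP=> _ /imsetP[y xy ->].
have Sy := subsetP (fus_class_subset Sx) y xy.
apply: fus_class_trans xy _; rewrite mem_fus_class connect1 //.
exact: fus_rel_conjg.
Qed.

(** For [k] prime to #|S| the k-th power map is a bijection of S whose inverse [h] is again a power
    map, and power maps respect fusion. *)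
Lemma fus_class_power_reindex (T : Type) (idx : T) (op : Monoid.com_law idx)
    (f : gT -> T) k x : x \in S -> coprime #|S| k ->
  \big[op/idx]_(y in fus_class (x ^+ k)%g) f y
    = \big[op/idx]_(y in fus_class x) f (y ^+ k)%g.
Proof.
move=> Sx co_k; pose h (y : gT) := (y ^+ expg_invn S k)%g.
have hK : {in S, cancel (fun y => y ^+ k)%g h} := expgK co_k.
have Kh : {in S, cancel h (fun y => y ^+ k)%g}.
  by move=> y Sy; rewrite /h -expgM mulnC expgM; apply: hK.
have inS := subsetP (fus_class_subset _).
rewrite (reindex_onto (fun y => y ^+ k)%g h) /= => [|y xy]; last first.
  by apply: Kh; apply: inS xy; rewrite groupX.
apply: eq_bigl => y; apply/andP/idP=> [[xy /eqP <-]|xy].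
  by rewrite -(hK x Sx); apply: fus_class_expg.
by rewrite fus_class_expg // hK ?eqxx // (inS _ _ _ xy).
Qed.


Local Notation n := #|S|.

(* Summing over the units k mod n makes the inner product with an irreducible *)
(* character Galois invariant, hence an integer (a sum of Ramanujan sums).    *)
Definition fus_delta (z : algC) (r : gT) (i : nat) : 'CF(S) :=
  \sum_(k < n | coprime n k)
    (n%:R * z ^+ (i * k)) *: '1_(fus_class (r ^+ k)%g).

Lemma fus_deltaE z r i x : r \in S ->
  fus_delta z r i x = n%:R *
    \sum_(k < n | coprime n k) z ^+ (i * k) *+ (x \in fus_class (r ^+ k)%g).
Proof.
move=> Sr; rewrite sum_cfunE mulr_sumr; apply: eq_bigr => k _.
by rewrite cfunE cfuniE ?fus_class_normal ?groupX // mulr_natr mulrnAr.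
Qed.

Lemma fus_delta_stable z r i x y : r \in S -> fus_conjugate F x y ->
  fus_delta z r i x = fus_delta z r i y.
Proof.
move=> Sr /fus_relP/connect1; rewrite -mem_fus_class => xy.
rewrite !fus_deltaE //; congr (_ * _); apply: eq_bigr => k _.
congr (_ *+ nat_of_bool _); apply/idP/idP=> rk; apply: fus_class_trans rk _ => //.
by rewrite fus_class_sym.
Qed.

Lemma fus_delta_vchar p z r i : prime p -> p.-group S -> z ^+ n = 1 -> r \in S ->
  fus_delta z r i \in 'Z[irr S].
Proof.
move=> p_pr pS zn1 Sr; rewrite [fus_delta z r i]cfun_sum_cfdot.
apply: rpred_sum => j _; apply: scale_zchar; last exact/char_vchar/irr_char.
have [m def_n] := p_natP pS.
(* The factor n in [fus_delta] cancels the 1/n of the inner product, and the power map carries each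
   sum back to the class of [r]. *)
have -> : '[fus_delta z r i, 'chi_j]
    = \sum_(y in fus_class r) \sum_(k < n | coprime n k)
        z ^+ (i * k) * 'chi_j (y^-1 ^+ k)%g.
  have dot_uni A : A <| S ->
      n%:R * '['1_A, 'chi_j] = \sum_(x in A) 'chi_j x^-1%g.
    move=> nA; rewrite (cfdotEl _ (cfuni_on _ A)) mulVKf ?neq0CG //.
    by apply: eq_bigr => x Ax; rewrite cfuniE // Ax mul1r irr_inv.
  rewrite cfdot_suml exchange_big /=; apply: eq_bigr => k co_k.
  rewrite cfdotZl mulrAC dot_uni ?fus_class_normal ?groupX // mulrC.
  rewrite (fus_class_power_reindex (GRing.add : Monoid.com_law _)) // mulr_sumr.
  by apply: eq_bigr => y _; rewrite expgVn.
apply: rpred_sum => y ry; have Sy := subsetP (fus_class_subset Sr) y ry.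
(* For each eigenvalue [e b] of [y^-1], the sum over [k] is the Ramanujan sum of the root of unity
   [z ^+ i * e b], whose order divides the prime power n. *)
have [d [e [e1 chi_e]]] := char_expg_sum (irr_char j) (groupVr Sy).
under eq_bigr => k _.
  rewrite chi_e mulr_sumr.
  under eq_bigr => b _ do rewrite exprM -exprMn.
  over.
rewrite exchange_big /=; apply: rpred_sum => b _.
rewrite def_n; apply: ramanujan_sum_int; rewrite // -def_n.
by rewrite exprMn e1 -exprM mulnC exprM zn1 expr1n mulr1.
Qed.

(** Fourier inversion modulo n: [z ^+ (i * n.-1)] is the inverse of [z ^+ i], so summing over [i]
    keeps only the term with k = 1 mod n. *)
Lemma fus_delta_inversion z r x : n.-primitive_root z -> r \in S ->
  \sum_(i < n) z ^+ (i * n.-1) * fus_delta z r i x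
    = n%:R ^+ 2 *+ (x \in fus_class r).
Proof.
move=> prim_z Sr; have n_gt0 : (0 < n)%N := cardG_gt0 S.
under eq_bigr do rewrite fus_deltaE // mulrCA.
rewrite -mulr_sumr expr2 -mulrnAr; congr (_ * _).
under eq_bigr do rewrite mulr_sumr.
rewrite exchange_big /=.
have sum_z (k : 'I_n) : \sum_(i < n) z ^+ (i * n.-1) *
     (z ^+ (i * k) *+ (x \in fus_class (r ^+ k)%g))
   = n%:R *+ (x \in fus_class (r ^+ k)%g) *+ (n %| n.-1 + k)%N.
  under eq_bigr do rewrite mulrnAr -exprD -mulnDr mulnC exprM.
  rewrite sumrMnl sum_expr_unity; last first.
    by rewrite -exprM mulnC exprM (prim_expr_order prim_z) expr1n.
  by rewrite -(prim_order_dvd prim_z) mulrnAC.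
under eq_bigr do rewrite sum_z.
(* The residue of 1 mod n; it is 0 when S is trivial. *)
pose k1 := Ordinal (ltn_pmod 1 n_gt0).
have r1 : (r ^+ k1)%g = r by rewrite /= -[RHS]expg1 expg_mod // expg_cardG.
rewrite (bigD1 k1) /=; last by rewrite coprime_modr coprimen1.
rewrite r1 /dvdn modnDmr addn1 prednK // modnn mulr1n big1 ?addr0 // => k.
case/andP=> _ ne_k; case: eqP; rewrite ?mulr0n // => nk.
case/eqP: ne_k; apply: val_inj => /=.
rewrite -[LHS](modn_small (ltn_ord k)); apply/eqP.
by rewrite -(eqn_modDl n.-1) nk addn1 prednK // modnn.
Qed.
End FusionClasses.
(** * Reduction modulo l *)

Section PrimeField.
Variables (K : fieldType) (l : nat) (lK : l \in [pchar K]).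

Local Notation L := (pPrimeCharType lK).

Lemma Fp_natr_intr (m : int) : ((m%:~R : 'F_l) : nat)%:R = m%:~R :> K.
Proof.
have := rmorph_int (GRing.in_alg L) m.
by rewrite /= -[m%:~R%:A]/(_%:R * 1) mulr1.
Qed.

(** Membership in a row space is unchanged by field extension ([map_submx]), here along the
    embedding [f] of F_l in K. *)
Lemma Fp_descent (T J : finType) (N : T -> J -> int) (a : J -> int) (k : T -> K) :
  (forall j, (a j)%:~R = \sum_t k t * (N t j)%:~R) ->
  exists b : T -> nat, forall j, (a j)%:~R = \sum_t (b t)%:R * (N t j)%:~R :> K.
Proof.
move=> def_a.
have [f fE] : exists f : {rmorphism 'F_l -> L}, forall x, f x = (x : nat)%:R.
  by exists (GRing.in_alg L) => x; rewrite /= -[x%:A]/(_%:R * 1) mulr1.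
pose A : 'rV['F_l]_#|J| := \row_j (a (enum_val j))%:~R.
pose NF : 'M['F_l]_(#|T|, #|J|) :=
  \matrix_(t, j) (N (enum_val t) (enum_val j))%:~R.
have /submxP[D def_A] : (A <= NF)%MS.
  rewrite -(map_submx f); apply/submxP.
  exists (\row_t (k (enum_val t) : L)); apply/rowP=> j.
  rewrite !mxE rmorph_int [LHS]def_a.
  rewrite (reindex (enum_val : 'I_#|T| -> T)) /=; last first.
    by apply: onW_bij; apply: enum_val_bij.
  by apply: eq_bigr => t _; rewrite !mxE rmorph_int.
exists (fun t => nat_of_ord (D 0 (enum_rank t) : 'F_l)) => j.
have /rowP/(_ (enum_rank j)) := def_A; rewrite !mxE enum_rankK.
move/(congr1 f); rewrite rmorph_int => ->; rewrite rmorph_sum.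
rewrite (reindex (enum_val : 'I_#|T| -> T)) /=; last first.
  by apply: onW_bij; apply: enum_val_bij.
apply: eq_bigr => t _.
by rewrite rmorphM fE mxE enum_rankK rmorph_int enum_valK.
Qed.
End PrimeField.

Lemma vchar_int_comb (gT : finGroupType) (G : {group gT}) (psi : 'CF(G)) :
  psi \in 'Z[irr G] -> exists a : Iirr G -> int, psi = \sum_j 'chi_j *~ a j.
Proof.
move=> Zpsi; have /fin_all_exists[a def_a] j : exists a : int, '[psi, 'chi_j] = a%:~R.
  exact/intrP/Cint_cfdot_vchar_irr.
exists a; rewrite [LHS]cfun_sum_cfdot; apply: eq_bigr => j _.
by rewrite def_a scaler_int.
Qed.

Section ResidueOfVchar.
Variables (K : fieldType) (pi : {rmorphism algint -> K}).
Variables (gT : finGroupType) (G : {group gT}).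

Lemma residue_vcharZ (psi : 'CF(G)) (m : int) x : psi \in 'Z[irr G] ->
  residue pi ((psi *~ m) x) = residue pi (psi x) *~ m.
Proof.
move=> Zpsi; rewrite -scaler_int cfunE residueM ?Aint_int ?Aint_vchar //.
by rewrite residue_int mulrzl.
Qed.

Lemma residue_vchar_sum (I : Type) (s : seq I) (psi : I -> 'CF(G)) (c : I -> int) x :
  (forall i, psi i \in 'Z[irr G]) ->
  residue pi ((\sum_(i <- s) psi i *~ c i) x)
    = \sum_(i <- s) residue pi (psi i x) *~ c i.
Proof.
move=> Zpsi; rewrite sum_cfunE residue_sum => [|i _].
  by apply: eq_bigr => i _; apply: residue_vcharZ.
by rewrite Aint_vchar // rpredMz.
Qed.
End ResidueOfVchar.

Section StableVchar.
Variables (gT : finGroupType) (S : {group gT}) (F : fusion_system S).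

Lemma stable_vchar_sum (I : Type) (s : seq I) (psi : I -> 'CF(S)) (c : I -> int) :
  (forall i, stable_vchar F (psi i)) ->
  stable_vchar F (\sum_(i <- s) psi i *~ c i).
Proof.
move=> st; split; first by apply: rpred_sum => i _; rewrite rpredMz //; case: (st i).
move=> x y xy; rewrite !sum_cfunE; apply: eq_bigr => i _.
by rewrite -!scaler_int !cfunE; case: (st i) => _ /(_ x y xy) ->.
Qed.

Lemma fus_conjugate_in s s' : fus_conjugate F s s' -> s \in S /\ s' \in S.
Proof.
case=> [P [Q [f [x [sP sQ _ <- <-]]]]].
by split; [apply: (subsetP sQ) | apply: (subsetP sP)]; apply: subgP.
Qed.

Lemma fus_root_in x : x \in S -> fingraph.root (fus_rel F) x \in S.
Proof.
move=> Sx; apply: (subsetP (fus_class_subset F Sx)).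
by rewrite mem_fus_class connect_root.
Qed.

Lemma fus_root_class x r : (x \in fus_class F r)
  = (fingraph.root (fus_rel F) r == fingraph.root (fus_rel F) x).
Proof. by rewrite mem_fus_class root_connect //; apply/sym_connect_sym/fus_rel_sym. Qed.

End StableVchar.

Lemma ffunMzE (aT : finType) (rT : zmodType) (f : {ffun aT -> rT}) (m : int) x :
  (f *~ m) x = f x *~ m.
Proof. by case: m => m; rewrite /intmul ?ffunE ffunMnE. Qed.

Section Reduction.
Variables (gT : finGroupType) (S : {group gT}) (p : nat) (F : fusion_system S).
Variables (l : nat) (K : fieldType) (pi : {rmorphism algint -> K}).
Hypotheses (p_pr : prime p) (pS : p.-group S) (lK : l \in [pchar K]).

Lemma reductionE (psi : 'CF(S)) (s : l'_elt S l) :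
  reduction l pi psi s = residue pi (psi (val s)).
Proof. by rewrite ffunE. Qed.

Lemma reduction_sum (I : Type) (s : seq I) (psi : I -> 'CF(S)) (c : I -> int) :
  (forall i, psi i \in 'Z[irr S]) ->
  reduction l pi (\sum_(i <- s) psi i *~ c i)
    = \sum_(i <- s) reduction l pi (psi i) *~ c i.
Proof.
move=> Zpsi; apply/ffunP=> x; rewrite reductionE residue_vchar_sum //.
rewrite sum_ffunE; apply: eq_bigr => i _.
by by rewrite ffunMzE reductionE.
Qed.

(** * The case of l prime to #|S| *)

Section Ordinary.
Hypothesis nzS : #|S|%:R != 0 :> K.

Local Notation n := #|S|.
Local Notation phi := (irr_residue pi).

Lemma mem_l'_elements x : x \in S -> x \in l'_elements S l.
Proof.
move=> Sx; have l_pr := pcharf_prime lK; rewrite inE Sx /=.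
apply: (pnat_dvd (order_dvdG Sx)); rewrite p'natE //.
by rewrite (dvdn_pcharf lK).
Qed.

Lemma residue_irr_comb (a : Iirr S -> int) x :
  residue pi ((\sum_j 'chi_j *~ a j) x) = \sum_j (a j)%:~R * phi j x.
Proof.
rewrite residue_vchar_sum => [|j]; last exact/char_vchar/irr_char.
by apply: eq_bigr => j _; rewrite mulrzl.
Qed.

(** Pairing with [phi j x^-1] recovers n times the j-th coefficient, and n is invertible in K. *)
Lemma irr_residue_free (a b : Iirr S -> K) :
  {in S, forall x, \sum_j a j * phi j x = \sum_j b j * phi j x} -> a =1 b.
Proof.
move=> eq_ab j; apply: (mulIf nzS).
have coef (c : Iirr S -> K) :
    \sum_(x in S) (\sum_i c i * phi i x) * phi j x^-1%g = c j * n%:R.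
  under eq_bigr do rewrite mulr_suml.
  rewrite exchange_big /= (bigD1 j) //= [X in _ + X]big1 ?addr0 => [|i ne_ij].
    under eq_bigr do rewrite -mulrA.
    by rewrite -mulr_sumr irr_residue_orthogonality // eqxx.
  under eq_bigr do rewrite -mulrA.
  by rewrite -mulr_sumr irr_residue_orthogonality // (negPf ne_ij) mulr0.
by rewrite -!coef; apply: eq_bigr => x Sx; rewrite eq_ab.
Qed.

(* The functions w below are stable virtual characters, whose K-span contains *)
(* the indicator functions of the fusion classes.                             *)
Lemma stable_reduction_lift (f : gT -> K) (a : Iirr S -> int) :
  (forall x, f x = \sum_j (a j)%:~R * phi j x) ->
  (forall s s', fus_conjugate F s s' -> f s = f s') ->
  exists2 psi, stable_vchar F psi & {in S, forall x, f x = residue pi (psi x)}.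
Proof.
move=> def_f f_stable; have n_gt0 : (0 < n)%N := cardG_gt0 S.
have [z prim_z] := C_prim_root_exists n_gt0.
have Az : z \in Aint := Aint_prim_root prim_z.
pose T := (subg_of S * 'I_n)%type.
pose w (t : T) := fus_delta F z (sgval t.1) t.2.
have st_w t : stable_vchar F (w t).
  split; first exact: (fus_delta_vchar F _ p_pr pS (prim_expr_order prim_z) (subgP t.1)).
  by move=> x y xy; apply: fus_delta_stable xy; apply: subgP.
have /fin_all_exists[N def_w] t := vchar_int_comb (st_w t).1.
pose rt := fingraph.root (fus_rel F).
(* The coefficients come from [fus_delta_inversion]; keeping only the canonical representative of
   each fusion class counts every class once. *)
pose k (t : T) := if rt (sgval t.1) == sgval t.1 then
  f (sgval t.1) * residue pi (z ^+ (t.2 * n.-1)) / n%:R ^+ 2 else 0.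
have f_span : {in S, forall x, f x = \sum_t k t * residue pi (w t x)}.
  move=> x Sx; rewrite -(pair_bigA _ (fun r i => k (r, i) * residue pi (w (r, i) x))) /=.
  have Sr : rt x \in S := fus_root_in F Sx.
  pose r := subg S (rt x); have val_r : sgval r = rt x by rewrite subgK.
  have sum_w (r' : subg_of S) : \sum_(i < n) k (r', i) * residue pi (w (r', i) x)
      = f (sgval r') *+ (r' == r).
    have -> : (r' == r)
        = (rt (sgval r') == sgval r') && (x \in fus_class F (sgval r')).
      rewrite fus_root_class -/rt -(inj_eq subg_inj) val_r.
      have rt_rt : rt (rt x) = rt x.
        by apply: root_root; apply/sym_connect_sym/fus_rel_sym.
      apply/idP/idP=> [/eqP-> | /andP[/eqP r'r' /eqP r'x]].
        by rewrite rt_rt !eqxx.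
      by rewrite -r'r' r'x.
    rewrite /k /=; case: (_ == _) => /=; last first.
      by rewrite mulr0n big1 // => i _; rewrite mul0r.
    transitivity (f (sgval r') / n%:R ^+ 2 * residue pi
        (\sum_(i < n) z ^+ (i * n.-1) * fus_delta F z (sgval r') i x)).
      rewrite residue_sum => [|i _]; last first.
        by rewrite rpredM ?rpredX // Aint_vchar //; case: (st_w (r', i)).
      rewrite mulr_sumr; apply: eq_bigr => i _.
      rewrite residueM ?rpredX // ?Aint_vchar //; last by case: (st_w (r', i)).
      by rewrite mulrA; congr (_ * _); rewrite mulrAC.
    rewrite fus_delta_inversion ?subgP //.
    rewrite -[X in residue pi X]mulr_natr -[X in residue pi (X * _)]natrX -natrM.
    by rewrite residue_nat natrM natrX mulrA divfK ?expf_neq0 // mulr_natr.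
  rewrite (bigD1 r) //= [X in _ = _ + X]big1 ?addr0 => [|r' ne_r].
    rewrite sum_w eqxx val_r.
    apply: esym; apply: fus_class_stable f_stable _.
    by rewrite mem_fus_class connect_root.
  by rewrite sum_w (negPf ne_r).
(* Comparing coefficients of the independent [phi j] turns [f_span] into a linear system with
   integral entries, solved in K by [k]. *)
have [|b def_a] := Fp_descent (N := N) (a := a) (k := k) lK.
  apply: irr_residue_free => x Sx; rewrite -def_f f_span //.
  under [RHS]eq_bigr do rewrite mulr_suml.
  rewrite exchange_big /=; apply: eq_bigr => t _.
  rewrite def_w residue_irr_comb mulr_sumr.
  by apply: eq_bigr => j _; rewrite mulrA.
exists (\sum_t w t *~ b t); first exact: stable_vchar_sum.
move=> x Sx; rewrite def_f residue_vchar_sum => [|t]; last by case: (st_w t).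
under eq_bigr do rewrite def_a mulr_suml.
rewrite exchange_big /=; apply: eq_bigr => t _.
rewrite -[RHS]mulrzl def_w residue_irr_comb mulr_sumr.
by apply: eq_bigr => j _; rewrite mulrA.
Qed.

Lemma l'_elt_in (s : l'_elt S l) : val s \in S.
Proof. by have := valP s; rewrite inE => /andP[]. Qed.

Lemma virtual_brauer_reduction v : stable_virtual_brauer_char F l K v ->
  exists2 psi, stable_vchar F psi & v = reduction l pi psi.
Proof.
case=> [_ [_ [[[n1 [r1 ->]] st1] [[n2 [r2 ->]] st2] ->]]].
have tr_comb m (r : mx_representation K S m) : exists a : Iirr S -> nat,
    {in S, forall g, \tr (r g) = \sum_j (a j)%:R * phi j g}.
  by apply: (repr_trace_irr_residue pi nzS lK (f := fun g => \tr (r g))); exists m, r.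
have [[a1 tr1] [a2 tr2]] := (tr_comb _ r1, tr_comb _ r2).
pose f x := \sum_j ((a1 j)%:Z - (a2 j)%:Z)%:~R * phi j x.
have f_tr x : x \in S -> f x = \tr (r1 x) - \tr (r2 x).
  move=> Sx; rewrite tr1 // tr2 // -sumrB; apply: eq_bigr => j _.
  by rewrite rmorphB /= mulrBl.
have [|x y xy|psi st_psi def_psi] :=
  @stable_reduction_lift f (fun j => (a1 j)%:Z - (a2 j)%:Z).
- by [].
- have [Sx Sy] := fus_conjugate_in xy; rewrite !f_tr //.
  pose sx : l'_elt S l := exist _ x (mem_l'_elements Sx).
  pose sy : l'_elt S l := exist _ y (mem_l'_elements Sy).
  have /= := st1 sx sy xy; have /= := st2 sx sy xy; rewrite !ffunE /=.
  by move=> -> ->.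
exists psi => //; apply/ffunP=> s; rewrite reductionE -def_psi ?l'_elt_in //.
by rewrite f_tr ?l'_elt_in // !ffunE.
Qed.

(** The reduction is already the trace of a genuine representation, so it is its own difference with
    0. *)
Lemma stable_virtual_of_vchar psi : stable_vchar F psi ->
  stable_virtual_brauer_char F l K (reduction l pi psi).
Proof.
case=> Zpsi st_psi; have [a def_psi] := vchar_int_comb Zpsi.
exists (reduction l pi psi), 0; split; last by rewrite subr0.
  split=> [|s t st]; last by rewrite !reductionE (st_psi _ _ st).
  have [m [r tr_r]] := irr_residue_comb_repr_trace pi nzS lK a.
  exists m, r; apply/ffunP=> s; rewrite reductionE def_psi residue_irr_comb.
  by rewrite tr_r ?l'_elt_in // ffunE.
split=> [|s t st]; last by rewrite !ffunE.
have [m [r tr_r]] := repr_trace0 K S.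
by exists m, r; apply/ffunP=> s; rewrite !ffunE -tr_r ?l'_elt_in.
Qed.

Lemma reduction_eq0 psi : psi \in 'Z[irr S] -> reduction l pi psi = 0 ->
  exists2 psi', psi' \in 'Z[irr S] & psi = psi' *+ l.
Proof.
move=> /vchar_int_comb[a def_psi] /ffunP red0.
have a0 j : (a j)%:~R = 0 :> K.
  apply: (irr_residue_free (a := fun j => (a j)%:~R) (b := fun=> 0)) => x Sx.
  rewrite [RHS]big1 => [|i _]; last by rewrite mul0r.
  rewrite -residue_irr_comb -def_psi.
  by have := red0 (exist _ x (mem_l'_elements Sx)); rewrite reductionE ffunE.
have /fin_all_exists[b def_a] j : exists b, a j = b * l%:Z.
  by apply/dvdzP; rewrite (dvdz_pcharf lK) a0.
exists (\sum_j 'chi_j *~ b j).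
  by apply: rpred_sum => j _; rewrite rpredMz // char_vchar ?irr_char.
rewrite def_psi -sumrMnl; apply: eq_bigr => j _.
by rewrite def_a mulrzA.
Qed.

End Ordinary.

(** * The case l = p *)

Section Modular.
Hypothesis lp : l = p.

Lemma l'_elt_modular (s : l'_elt S l) : val s = 1%g.
Proof.
have := valP s; rewrite inE => /andP[Ss]; move: (val s) Ss => x Sx l'x.
apply/eqP; rewrite -order_eq1; apply/eqP.
by apply: (pnat_1 (mem_p_elt pS Sx)); rewrite -lp.
Qed.

Lemma stable_modular (f : {ffun l'_elt S l -> K}) : fus_stable F val f.
Proof. by move=> s t _; congr (f _); apply: val_inj; rewrite !l'_elt_modular. Qed.

(** Only the degrees [n1] and [n2] are visible at the identity, and their difference times the
    trivial character is a lift. *)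
Lemma virtual_brauer_reduction_modular v : stable_virtual_brauer_char F l K v ->
  exists2 psi, stable_vchar F psi & v = reduction l pi psi.
Proof.
case=> [_ [_ [[[n1 [r1 ->]] _] [[n2 [r2 ->]] _] ->]]].
exists (1 *~ (n1%:Z - n2%:Z)).
  split; first by rewrite rpredMz // rpred1.
  move=> x y /fus_conjugate_in[Sx Sy].
  by rewrite -!scaler_int !cfunE !cfun1E Sx Sy.
apply/ffunP=> s; rewrite reductionE l'_elt_modular residue_vcharZ ?rpred1 //.
rewrite cfun11 residue1 !ffunE l'_elt_modular !repr_mx1 !mxtrace1.
by rewrite -[RHS]/(_%:~R) rmorphB.
Qed.

(** The reduction is the constant [psi 1] mod l, the trace of a trivial action of dimension
    congruent to [psi 1]. *)
Lemma stable_virtual_of_vchar_modular psi : stable_vchar F psi ->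
  stable_virtual_brauer_char F l K (reduction l pi psi).
Proof.
case=> Zpsi _; have /intrP[m psi1] := Cint_vchar1 Zpsi.
have [a def_a] := intr_pchar_nat m lK.
have scalar_trace (d : nat) : exists n (rho : mx_representation K S n),
    brauer_char l rho = [ffun=> d%:R].
  have triv_repr : mx_repr S (fun=> 1%:M : 'M[K]_d).
    by split=> // x y _ _; rewrite mulmx1.
  exists d, (MxRepresentation triv_repr).
  by apply/ffunP=> s; rewrite !ffunE mxtrace1.
exists [ffun=> a%:R], [ffun=> 0%:R]; split.
- by split; [have [n [r <-]] := scalar_trace a; exists n, r | apply: stable_modular].
- by split; [have [n [r <-]] := scalar_trace 0; exists n, r | apply: stable_modular].
apply/ffunP=> s; rewrite reductionE l'_elt_modular psi1 residue_int def_a.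
by rewrite !ffunE subr0.
Qed.
End Modular.
End Reduction.

(** * Transfer of bases along reduction *)

Lemma sum_act_map (A : nzRingType) (U V : zmodType) (act : A -> V -> V)
    (f : U -> V) (B : seq U) (c : 'I_(size [seq f x | x <- B]) -> A) :
  \sum_i act (c i) [seq f x | x <- B]`_i
    = \sum_(i < size B) act (c (cast_ord (esym (size_map f B)) i)) (f B`_i).
Proof.
rewrite (reindex (cast_ord (esym (size_map f B)))) /=.
  by apply: eq_bigr => i _; rewrite (nth_map 0).
by exists (cast_ord (size_map f B)) => i _; rewrite ?cast_ordK ?cast_ordKV.
Qed.

Lemma Flact_intr (K : fieldType) (l : nat) (I : finType) (m : int)
    (v : {ffun I -> K}) : l \in [pchar K] -> Flact (m%:~R : 'F_l) v = v *~ m.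
Proof.
move=> lK; apply/ffunP=> x; rewrite ffunMnE ffunMzE.
by rewrite -mulr_natr (Fp_natr_intr lK) mulrzr.
Qed.

Theorem theoremC (gT : finGroupType) (S : {group gT}) (p : nat)
    (F : fusion_system S) (l : nat) (K : closedFieldType)
    (M : {pred algint}) (pi : {rmorphism algint -> K}) (B : seq 'CF(S)) :
  prime p -> p.-group S -> prime l ->
  maximal_ideal M -> l%:R \in M ->
  is_algebraic_closure_Fp l K ->
  (forall y : K, exists x : algint, pi x = y) ->
  (forall x : algint, (x \in M) = (pi x == 0)) ->
  is_basis (@Zact 'CF(S)) (stable_vchar F) B ->
  (l <> p \/ S :=: 1%g ->
     is_basis (@Flact l {ffun l'_elt S l -> K})
       (stable_virtual_brauer_char F l K)
       [seq reduction l pi psi | psi <- B]) /\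
  generates (@Flact l {ffun l'_elt S l -> K})
    (stable_virtual_brauer_char F l K)
    [seq reduction l pi psi | psi <- B].
Proof.
move=> p_pr pS l_pr _ _ [lK _] _ _ [genB indB].
have st_B (i : 'I_(size B)) : stable_vchar F B`_i.
  apply/genB; exists (fun j => (j == i)%:R).
  rewrite (bigD1 i) //= eqxx big1 ?addr0 => [|j /negPf ->].
    by rewrite /Zact mulr1z.
  by rewrite /Zact mulr0z.
have Z_B i := (st_B i).1.
have red_sum (c : 'I_(size B) -> int) :
    reduction l pi (\sum_i Zact (c i) B`_i)
      = \sum_(i < size B) Flact ((c i)%:~R : 'F_l) (reduction l pi B`_i).
  by rewrite /Zact reduction_sum //; apply: eq_bigr => i _; rewrite Flact_intr.
(* Once reduction is known to be onto, generation transfers by reducing integral coefficients mod l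
   and, conversely, lifting coefficients in F_l to their natural representatives. *)
have gen_red :
    (forall v, stable_virtual_brauer_char F l K v ->
       exists2 psi, stable_vchar F psi & v = reduction l pi psi) ->
    (forall psi, stable_vchar F psi ->
       stable_virtual_brauer_char F l K (reduction l pi psi)) ->
    generates (@Flact l {ffun l'_elt S l -> K})
      (stable_virtual_brauer_char F l K) [seq reduction l pi psi | psi <- B].
  move=> lift virt v; split=> [/lift[psi /genB[c ->] ->] | [c ->]].
    rewrite red_sum; exists (fun i => (c (cast_ord (size_map _ B) i))%:~R).
    by rewrite sum_act_map; apply: eq_bigr => i _; rewrite cast_ordKV.
  pose d i : 'F_l := c (cast_ord (esym (size_map (reduction l pi) B)) i).
  have red_d : reduction l pi (\sum_i Zact (d i : nat)%:Z B`_i)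
      = \sum_(i < size B) Flact (d i) (reduction l pi B`_i).
    rewrite red_sum; apply: eq_bigr => i _; congr (Flact _ _).
    by rewrite -[RHS]natr_Zp.
  rewrite sum_act_map -[X in stable_virtual_brauer_char _ _ _ X]red_d.
  exact/virt/stable_vchar_sum.
(* If l divides #|S|, then l = p and S is nontrivial, so the claim about a basis is vacuous and
   generation remains. *)
have [l_n | l'n] := boolP (l %| #|S|)%N.
  have lp : l = p.
    have /p_natP[m n_pm] := pS; move: l_n; rewrite n_pm.
    case: m {n_pm} => [|m]; first by rewrite dvdn1 => /eqP l1; rewrite l1 in l_pr.
    by rewrite Euclid_dvdX // andbT dvdn_prime2 // => /eqP.
  split=> [[]// S1|].
    have l1 : (l %| 1)%N by rewrite -(cards1 (1%g : gT)) -[X in #|pred_of_set X|]S1.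
    by rewrite dvdn1 in l1; rewrite (eqP l1) in l_pr.
  apply: gen_red => [v | psi].
    exact: (virtual_brauer_reduction_modular pi pS lp).
  exact: (stable_virtual_of_vchar_modular pi pS lK lp).
have nzS : #|S|%:R != 0 :> K by rewrite -(dvdn_pcharf lK).
have {}gen_red := gen_red
  (virtual_brauer_reduction pi p_pr pS lK nzS)
  (stable_virtual_of_vchar pi lK nzS).
split=> // _; split=> // c; rewrite sum_act_map.
pose d i : 'F_l := c (cast_ord (esym (size_map (reduction l pi) B)) i).
rewrite -[X in X = 0]/(\sum_i Flact (d i) _) => d0.
have dE i : (d i : nat)%:Z%:~R = d i :> 'F_l by rewrite -[RHS]natr_Zp.
suff d_eq0 i : d i = 0.
  by move=> i; rewrite -(d_eq0 (cast_ord (size_map _ B) i)) /d cast_ordK.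
(* The integral lift of the relation has zero reduction, hence is l times a virtual character. *)
pose psi := \sum_i Zact (d i : nat)%:Z B`_i.
have [st_psi red0] : stable_vchar F psi /\ reduction l pi psi = 0.
  split; first exact: stable_vchar_sum.
  by rewrite red_sum -[RHS]d0; apply: eq_bigr => j _; rewrite dE.
have [psi' Zpsi' def_psi] := reduction_eq0 lK nzS st_psi.1 red0.
(* Cancelling l in algC makes [psi'] stable, so it expands on B; independence of B over the integers
   then makes each [d i] a multiple of l. *)
have /genB[b def_psi'] : stable_vchar F psi'.
  split=> // x y /st_psi.2; rewrite def_psi -!scaler_nat !cfunE.
  by apply: mulfI; rewrite pnatr_eq0 -lt0n prime_gt0.
have d_i : (d i : nat)%:Z = b i * l%:Z.
  apply/eqP; rewrite -subr_eq0; apply/eqP.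
  apply: (indB (fun j => (d j : nat)%:Z - b j * l%:Z)) i.
  under eq_bigr do rewrite /Zact mulrzBr mulrzA.
  rewrite sumrB -mulrz_suml.
  by rewrite -[X in X *~ _]def_psi' -pmulrn -def_psi subrr.
by rewrite -dE d_i intrM (pchar_Fp_0 l_pr : l%:~R = 0) mulr0.
Qed.
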